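(* If $S\in\Delta^1_n$, then $$E(S)=\frac{1}{\pi}\int_{-\infty}^{\infty}\frac{1}{z^2}\log\Big[1+\sum_{j=1}^{\lfloor n/2\rfloor}c_{2j}(S)\,z^{2j}\Big]\,dz .$$ In particular, if $S_1,S_2\in\Delta^1_n$ and $S_1\prec S_2$, then $E(S_1)<E(S_2)$.
   Context: A sidigraph is a digraph (no loops, at most one arc from $u$ to $v$) with a sign $\sigma(a)\in\{-1,1\}$ on each arc; its adjacency matrix $A(S)$ has entry $\sigma(v_i,v_j)$ if there is an arc from $v_i$ to $v_j$ and $0$ otherwise, and $\phi_S(z)=\det(zI-A(S))$. The energy of a sidigraph $S$ with eigenvalues $z_1,\dots,z_n$ is $E(S)=\sum_{j=1}^n|\Re z_j|$. The sign of a directed cycle is the product of its arc signs. $\Delta^1_n$ is the class of sidigraphs on $n$ vertices whose underlying digraph is bipartite and in which every directed cycle of length $\equiv 0\pmod 4$ is negative and every directed cycle of length $\equiv 2\pmod 4$ is positive. For $S\in\Delta^1_n$, $c_{2j}(S)$ is the number of linear subsidigraphs of $S$ of order $2j$ (subsidigraphs on $2j$ vertices in which every vertex has indegree and outdegree $1$); for such $S$ one has $\phi_S(z)=z^n+\sum_{j=1}^{\lfloor n/2\rfloor}(-1)^jc_{2j}(S)z^{n-2j}$. For $S_1,S_2\in\Delta^1_n$, write $S_1\preceq S_2$ if $c_{2j}(S_1)\le c_{2j}(S_2)$ for all $j=1,\dots,\lfloor n/2\rfloor$, and $S_1\prec S_2$ if moreover strict inequality holds for some $j$. *)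

(* Defs.v *)
From HB Require Import structures.
From mathcomp Require Import all_boot all_order all_algebra all_fingroup.
Set Implicit Arguments. Unset Strict Implicit. Unset Printing Implicit Defensive.
Import GRing.Theory.

(* Sidigraphs on the vertex set 'I_n, represented by their adjacency
   matrix A(S) : entry A i j = sigma(v_i,v_j) if there is an arc from
   v_i to v_j, and 0 otherwise.                                        *)

Definition is_sidigraph (n : nat) (A : 'M[int]_n) : Prop :=
  forall i j : 'I_n,
    (i = j -> A i j = 0%R) /\
    (A i j = 0%R \/ A i j = 1%R \/ A i j = (-1)%R).

Definition arc (n : nat) (A : 'M[int]_n) : rel 'I_n := fun i j => A i j != 0%R.

Definition bipartite_digraph (n : nat) (A : 'M[int]_n) : Prop :=
  exists col : 'I_n -> bool, forall i j, arc A i j -> col i != col j.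

Definition dicycle (n : nat) (A : 'M[int]_n) (s : seq 'I_n) : bool :=
  [&& (1 < size s)%N, uniq s & path.cycle (arc A) s].

Definition cycle_sign (n : nat) (A : 'M[int]_n) (s : seq 'I_n) : int :=
  (\prod_(p <- zip s (rot 1 s)) A p.1 p.2)%R.

Definition Delta1 (n : nat) (A : 'M[int]_n) : Prop :=
  is_sidigraph A /\ bipartite_digraph A /\
  forall s, dicycle A s ->
    ((size s %% 4 = 0)%N -> cycle_sign A s = (-1)%R) /\
    ((size s %% 4 = 2)%N -> cycle_sign A s = 1%R).

(* c_k(S): number of linear subsidigraphs of order k.  A linear subsidigraph
   (every vertex has in- and outdegree 1 inside it) corresponds bijectively to
   the permutation sending each of its vertices to its unique out-neighbour
   (identity outside); its order is the size of the support. *)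
Definition lin_count (n : nat) (A : 'M[int]_n) (k : nat) : nat :=
  #|[set s : 'S_n | (#|[set i | s i != i]| == k) &&
                    [forall i, (s i != i) ==> arc A i (s i)]]|.

Definition sprec (n : nat) (A1 A2 : 'M[int]_n) : Prop :=
  (forall j, (1 <= j <= n./2)%N -> (lin_count A1 (2 * j) <= lin_count A2 (2 * j))%N) /\
  (exists j, (1 <= j <= n./2)%N /\ (lin_count A1 (2 * j) < lin_count A2 (2 * j))%N).

From Stdlib Require Import Reals.

Definition intR (z : int) : R :=
  match z with
  | Posz m => INR m
  | Negz m => (- INR m.+1)%R
  end.

Definition cpx : Type := (R * R)%type.
Definition Cadd (a b : cpx) : cpx := ((a.1 + b.1)%R, (a.2 + b.2)%R).
Definition Csub (a b : cpx) : cpx := ((a.1 - b.1)%R, (a.2 - b.2)%R).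
Definition Cmul (a b : cpx) : cpx :=
  ((a.1 * b.1 - a.2 * b.2)%R, (a.1 * b.2 + a.2 * b.1)%R).
Definition Cof (x : R) : cpx := (x, 0%R).

Definition Ceval (cs : seq R) (z : cpx) : cpx :=
  foldr (fun c acc => Cadd (Cof c) (Cmul z acc)) (Cof 0) cs.

Definition charpoly_evalC (n : nat) (A : 'M[int]_n) (z : cpx) : cpx :=
  Ceval (map intR (polyseq (char_poly A))) z.

Definition eigenvalues (n : nat) (A : 'M[int]_n) (zs : seq cpx) : Prop :=
  size zs = n /\
  forall z : cpx, charpoly_evalC A z = foldr (fun w acc => Cmul (Csub z w) acc) (Cof 1) zs.

Definition energy (zs : seq cpx) : R := foldr (fun w acc => (Rabs w.1 + acc)%R) 0%R zs.

Definition integrand (n : nat) (A : 'M[int]_n) (x : R) : R :=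
  (/ (x ^ 2) * ln (1 + foldr Rplus 0
        (map (fun j => INR (lin_count A (2 * j)) * x ^ (2 * j)) (iota 1 n./2))))%R.

Definition improper_integral (f : R -> R) (I : R) : Prop :=
  exists pr : (forall a b : R, Riemann_integrable f a b),
    forall eps : R, (0 < eps)%R ->
      exists M : R, forall a b : R, (a <= - M)%R -> (M <= b)%R ->
        (Rabs (RiemannInt (pr a b) - I) < eps)%R.

(* Main.v *)
(** Expanding det(zI - A) over permutations, only the permutations all of whose
    nontrivial cycles are dicycles of A contribute.  For such a permutation every
    cycle has even length L, and the cycle sign condition makes the cycle
    contribute (-1)^(L/2); hence at z = i/x the characteristic polynomial is
    (i/x)^n psi(x) with psi(x) = 1 + sum_j c_{2j} x^{2j} >= 1.  Comparing squared
    moduli, psi(x)^2 is the product over the eigenvalues a + ib of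
    q(x) = (1 - b x)^2 + (a x)^2.  As psi is even, ln psi(x) / x^2 is a sum of terms
    (ln q(x) + ln q(-x)) / (4 x^2); each has an odd elementary primitive that tends
    to |a| pi/2 at +oo, which gives the integral formula.  Strict monotonicity
    holds because the primitives for S_2 and S_1 differ by an increasing function
    vanishing at 0. *)
Require Import Defs.
From HB Require Import structures.
From mathcomp Require Import all_boot all_order all_algebra all_fingroup.
Set Implicit Arguments. Unset Strict Implicit. Unset Printing Implicit Defensive.
Import GRing.Theory.
Local Open Scope ring_scope.

(** * Signs of linear subsidigraphs *)

Definition supp (n : nat) (s : 'S_n) : {set 'I_n} := [set i | s i != i].

Definition linear_perms (n : nat) (A : 'M[int]_n) : {set 'S_n} :=
  [set s : 'S_n | [forall i, (s i != i) ==> Defs.arc A i (s i)]].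

Lemma path_alternates (T : eqType) (e : rel T) (col : T -> bool) (x : T) p :
  (forall i j, e i j -> col i != col j) ->
  path e x p -> col (last x p) = col x (+) odd (size p).
Proof.
move=> ecol; elim: p x => [|y p IHp] x /=; first by rewrite addbF.
case/andP=> /ecol exy /IHp ->; move: exy.
by case: (col x); case: (col y); case: (odd _).
Qed.

Lemma prod_zip_map (R : pzSemiRingType) (T : Type) (F : T -> T -> R) f (t : seq T) :
  \prod_(p <- zip t (map f t)) F p.1 p.2 = \prod_(i <- t) F i (f i).
Proof. by elim: t => [|i t IHt] /=; rewrite ?big_nil // !big_cons IHt. Qed.

(** After [#|porbit s x|] steps the trajectory is back at [x]. This supplies the closing arc for
    [path.cycle] and the last entry of [rot 1]. *)
Lemma traject_porbitE (T : finType) (s : {perm T}) x :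
  rcons (traject s (s x) #|porbit s x|.-1) x = traject s (s x) #|porbit s x|.
Proof.
have := iter_porbit s x.
case: #|porbit s x| (card_porbit_neq0 s x) => // m _ itx.
by rewrite trajectSr -iterSr itx.
Qed.

Section Orbit.

Variables (n : nat) (A : 'M[int]_n) (s : 'S_n) (x : 'I_n).
Hypotheses (s_lin : s \in linear_perms A) (x_moved : s x != x).

Let t := traject s x #|porbit s x|.

Lemma traject_cons : t = x :: traject s (s x) #|porbit s x|.-1.
Proof.
by rewrite /t; case: #|porbit s x| (card_porbit_neq0 s x).
Qed.

Lemma path_linear_perm m : path (Defs.arc A) x (traject s (s x) m).
Proof.
suff: forall y, s y != y -> path (Defs.arc A) y (traject s (s y) m) by apply.
elim: m => //= m IHm y y_moved.
rewrite IHm ?(inj_eq perm_inj) // andbT.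
by move: s_lin; rewrite inE => /forallP/(_ y)/implyP; apply.
Qed.

Lemma card_porbit_gt1 : (1 < #|porbit s x|)%N.
Proof.
have := iter_porbit s x; have := card_porbit_neq0 s x.
by case: #|porbit s x| => [|[|//]] //= _ /eqP; rewrite (negPf x_moved).
Qed.

Lemma dicycle_porbit : dicycle A t.
Proof.
rewrite /dicycle size_traject card_porbit_gt1 uniq_traject_porbit /=.
by rewrite traject_cons /= traject_porbitE path_linear_perm.
Qed.

Lemma cycle_sign_porbit : cycle_sign A t = \prod_(i in porbit s x) A i (s i).
Proof.
rewrite /cycle_sign.
(* Rotating an orbit listed along [s] amounts to applying [s], so the zip pairs each vertex with its
   out-neighbour. *)
have -> : rot 1 t = map s t.
  have map_t m y : map s (traject s y m) = traject s (s y) m.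
    by elim: m y => //= m IHm y; rewrite IHm.
  by rewrite [RHS]map_t -traject_porbitE traject_cons rot1_cons.
rewrite prod_zip_map (eq_bigl _ _ (porbit_traject s x)).
by rewrite big_uniq ?uniq_traject_porbit.
Qed.

(** The walk along the orbit is closed and every arc flips the colour, so the number of flips is
    even. *)
Lemma porbit_even : bipartite_digraph A -> ~~ odd #|porbit s x|.
Proof.
case=> col ecol; have := path_alternates ecol (path_linear_perm #|porbit s x|).
rewrite last_traject iter_porbit size_traject.
by case: (col x); case: (odd _).
Qed.

(** For even length [L] the minus signs cancel and the cycle sign is left: -1 if [L] is 0 mod 4, +1
    if [L] is 2 mod 4. The parity of [L/2] separates the two cases. *)
Lemma porbit_sign : Delta1 A ->
  \prod_(i in porbit s x) - A i (s i) = - (-1) ^+ (#|porbit s x|./2).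
Proof.
case=> _ [bipA] /(_ t dicycle_porbit).
rewrite size_traject cycle_sign_porbit => -[mod0 mod2].
rewrite prodrN -[X in (-1) ^+ X * _]odd_double_half.
have ev := porbit_even bipA.
rewrite (negbTE ev) add0n -mul2n exprM sqrrN !expr1n mul1r.
have /esym := odd_double_half #|porbit s x|; rewrite (negbTE ev) add0n => eq_o.
have := odd_double_half (#|porbit s x|./2); case: (odd _) => /= eq_h.
  rewrite -eq_h mod2 ?exprD ?expr1 -?mul2n ?exprM ?sqrrN ?expr1n ?mulr1 ?opprK //.
  by rewrite eq_o -eq_h -!mul2n mulnDr mulnA muln1 -modnDmr modnMr.
rewrite -eq_h add0n -mul2n exprM sqrrN !expr1n mod0 //.
by rewrite eq_o -eq_h -!mul2n mulnA modnMr.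
Qed.

End Orbit.

(** * From single orbits to whole permutations *)

Lemma big_porbits (R : Type) (idx : R) (op : Monoid.com_law idx)
    (T : finType) (s : {perm T}) (F : T -> R) :
  \big[op/idx]_i F i =
  \big[op/idx]_(o in porbits s) \big[op/idx]_(i in o) F i.
Proof.
rewrite (partition_big (porbit s) [in porbits s]) => [|i _]; last exact: imset_f.
apply: eq_bigr => o /imsetP[x _ ->]; apply: eq_bigl => i.
by rewrite /= eq_porbit_mem.
Qed.

(** A cycle of length [L] has sign [(-1)^(L-1)]. In the library the parity of [s] is that of the
    cardinal of [T] plus the number of orbits, which splits orbit by orbit. *)
Lemma odd_perm_porbits (T : finType) (s : {perm T}) :
  (-1) ^+ s = \prod_(o in porbits s) - (-1) ^+ #|o| :> int.
Proof.
rewrite prodrN /odd_perm signr_addb !signr_odd mulrC; congr (_ * _).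
rewrite -prodr_const (big_porbits _ s).
by apply: eq_bigr => o _; rewrite prodr_const.
Qed.

Lemma porbit_fixed (T : finType) (s : {perm T}) x : s x = x -> porbit s x = [set x].
Proof.
move=> sx; apply/setP => i; rewrite inE.
apply/idP/eqP => [/porbitP[k ->] | ->]; last exact: porbit_id.
by elim: k => [|k IHk]; rewrite ?perm1 // expgSr permM IHk.
Qed.

Lemma porbit_moved (T : finType) (s : {perm T}) x i :
  s x != x -> i \in porbit s x -> s i != i.
Proof.
move=> sx; rewrite porbit_sym => x_i; apply: contra_neq sx => si.
by move: x_i; rewrite porbit_fixed // inE => /eqP->.
Qed.

Lemma card_supp_le (n : nat) (s : 'S_n) : (#|supp s| <= n)%N.
Proof. by rewrite -[X in (_ <= X)%N]card_ord max_card. Qed.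

Section LinearPerm.

Variables (n : nat) (A : 'M[int]_n).
Hypothesis A_D1 : Delta1 A.

(** Fixed points are orbits of size 1, whose half rounds down to 0; all other orbits are even. *)
Lemma card_supp_porbits (s : 'S_n) : s \in linear_perms A ->
  #|supp s| = (\sum_(o in porbits s) #|o|./2).*2.
Proof.
move=> s_lin; rewrite -sum1dep_card big_mkcond (big_porbits _ s) /= -mul2n big_distrr /=.
apply: eq_bigr => _ /imsetP[x _ ->]; have [sx | sx] := eqVneq (s x) x.
  by rewrite porbit_fixed // big_set1 cards1 sx eqxx.
rewrite (eq_bigr (fun=> 1%N)) => [|i]; last by move=> /(porbit_moved sx) ->.
rewrite sum1_card mul2n -[LHS]odd_double_half.
by rewrite (negPf (porbit_even s_lin sx _)) //; case: A_D1 => _ [].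
Qed.

(** A nontrivial orbit of even length [L] has permutation sign -1, and its entries contribute
    [-(-1)^(L/2)]; the two minus signs cancel. A fixed point contributes 1. *)
Lemma linear_perm_sign (s : 'S_n) : s \in linear_perms A ->
  (-1) ^+ s * \prod_(i in supp s) - A i (s i) = (-1) ^+ (#|supp s|./2).
Proof.
move=> s_lin; rewrite card_supp_porbits // doubleK -prodrXr odd_perm_porbits.
rewrite [\prod_(i in supp s) _]big_mkcond (big_porbits _ s) /= -big_split /=.
apply: eq_bigr => _ /imsetP[x _ ->]; have [sx | sx] := eqVneq (s x) x.
  by rewrite porbit_fixed // big_set1 cards1 inE sx eqxx.
rewrite (eq_bigr (fun i => - A i (s i))) => [|i]; last first.
  by move=> /(porbit_moved sx); rewrite inE => ->.
rewrite porbit_sign // mulrNN -signr_odd (negPf (porbit_even s_lin sx _)) ?mul1r //.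
by case: A_D1 => _ [].
Qed.

Lemma linear_perm_even (s : 'S_n) : s \in linear_perms A -> ~~ odd #|supp s|.
Proof. by move=> s_lin; rewrite card_supp_porbits // odd_double. Qed.

(** In the Leibniz expansion a moved vertex without an arc to its image gives a zero factor, and a
    fixed vertex gives ['X] because there are no loops. *)
Lemma char_poly_linear_perms :
  char_poly A =
  \sum_(s in linear_perms A) ((-1) ^+ (#|supp s|./2))%:P * 'X^(n - #|supp s|).
Proof.
have A0 i : A i i = 0 by case: A_D1 => /(_ i i) [-> //].
rewrite /char_poly /determinant [RHS]big_mkcond /=; apply: eq_bigr => s _.
case: ifPn => s_lin; last first.
  move: s_lin; rewrite inE negb_forall => /existsP[i].
  rewrite negb_imply negbK => /andP[si /eqP Ai].
  rewrite (bigD1 i) //= !mxE eq_sym (negPf si) Ai.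
  by rewrite mulr0n polyC0 subr0 mul0r mulr0.
rewrite -linear_perm_sign // rmorphM /= rmorphXn rmorphN1 -mulrA; congr (_ * _).
rewrite (bigID [in supp s]) /= rmorph_prod; congr (_ * _).
  apply: eq_bigr => i; rewrite !mxE inE eq_sym => /negPf->.
  by rewrite mulr0n sub0r rmorphN.
rewrite (eq_bigr (fun=> 'X)) => [|i].
  rewrite prodr_const; congr (_ ^+ _); apply/eqP.
  rewrite -(eqn_add2l #|supp s|) subnKC ?card_supp_le //.
  by have := cardC (mem (supp s)); rewrite card_ord => /eqP.
by rewrite inE negbK => /eqP si; rewrite !mxE si eqxx A0 polyC0 subr0.
Qed.

(** The permutations are grouped by half the size of their support, which is always even. *)
Lemma sum_linear_perms (R : comNzRingType) (x : R) :
  \sum_(s in linear_perms A) x ^+ #|supp s| =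
  1 + \sum_(1 <= j < (n./2).+1) (lin_count A (2 * j))%:R * x ^+ (2 * j).
Proof.
pose h (s : 'S_n) : 'I_(n./2).+1 := inord (#|supp s|./2).
have hE s : h s = #|supp s|./2 :> nat by rewrite inordK // ltnS half_leq ?card_supp_le.
have supp_half s : s \in linear_perms A -> #|supp s| = (2 * (#|supp s|./2))%N.
  by move=> /linear_perm_even/negPf ev; rewrite mul2n -[LHS]odd_double_half ev.
rewrite (partition_big h predT) //= (eq_bigr (fun j : 'I__ =>
    (lin_count A (2 * j))%:R * x ^+ (2 * j))) => [|j _]; last first.
  rewrite (eq_bigr (fun=> x ^+ (2 * j))) => [|s /andP[s_lin /eqP <-]]; last first.
    by rewrite hE -supp_half.
  rewrite sumr_const mulr_natl; congr (_ *+ _).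
  apply: eq_card => s; rewrite !inE unfold_in /= andbC.
  have [s_lin | ] := boolP (s \in linear_perms A); last by rewrite inE => /negPf->; rewrite !andbF.
  move: (s_lin); rewrite inE => ->; rewrite !andbT -val_eqE /= hE.
  by rewrite -[#|[set i | _]|]/(#|supp s|) (supp_half s s_lin) eqn_mul2l /= mul2n doubleK.
rewrite -(big_mkord xpredT (fun j => (lin_count A (2 * j))%:R * x ^+ (2 * j))).
rewrite big_nat_recl // big_add1 /=; congr (_ + _); rewrite muln0 expr0 mulr1.
(* The block [j = 0] is the leading 1: an empty support forces the identity. *)
rewrite /lin_count (_ : [set s | _] = [set 1%g]) ?cards1 //.
apply/setP => s; rewrite !inE cards_eq0; apply/andP/eqP => [[/eqP s0 _]|->].
  by apply/permP => i; rewrite perm1; have := in_set0 i; rewrite -s0 inE => /negbFE/eqP.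
by split; [apply/eqP/setP => i | apply/forallP => i]; rewrite ?inE perm1 eqxx.
Qed.

End LinearPerm.

From mathcomp Require Import complex Rstruct.
From Stdlib Require Import Reals Lra.

(** * The characteristic polynomial on the imaginary axis *)

Definition psi (n : nat) (A : 'M[int]_n) (x : R) : R :=
  (1 + foldr Rplus 0
         (map (fun j => INR (lin_count A (2 * j)) * x ^ (2 * j)) (iota 1 n./2)))%R.

(* For w = a + ib, this is |1 + i x w|^2. *)
Definition quad (w : cpx) (x : R) : R :=
  ((1 - w.2 * x) ^ 2 + (w.1 * x) ^ 2)%R.

Definition Cnorm2 (z : cpx) : R := (z.1 ^ 2 + z.2 ^ 2)%R.

Definition toC (z : cpx) : R[i] := Complex z.1 z.2.

Lemma intRE (z : int) : intR z = z%:~R :> R.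
Proof. by case: z => m; rewrite /intR INRE ?NegzE ?mulrNz. Qed.

Lemma toC_add z w : toC (Cadd z w) = toC z + toC w. Proof. by []. Qed.
Lemma toC_mul z w : toC (Cmul z w) = toC z * toC w. Proof. by []. Qed.

Lemma charpoly_evalC_horner (n : nat) (A : 'M[int]_n) (z : cpx) :
  toC (charpoly_evalC A z) = (map_poly intr (char_poly A)).[toC z].
Proof.
rewrite /charpoly_evalC map_polyE horner_Poly.
elim: (polyseq _) => [//|c cs IHcs] /=.
rewrite toC_add toC_mul IHcs addrC mulrC; congr (_ + _).
by rewrite /toC /= intRE -[RHS](rmorph_int (real_complex R)).
Qed.

Lemma Cnorm2_mul z w : Cnorm2 (Cmul z w) = (Cnorm2 z * Cnorm2 w)%R.
Proof. by rewrite /Cnorm2 /=; ring. Qed.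

Lemma psiE (n : nat) (A : 'M[int]_n) (x : R) :
  Delta1 A -> psi A x = \sum_(s in linear_perms A) x ^+ #|supp s|.
Proof.
move=> A_D1; rewrite sum_linear_perms // /psi.
rewrite foldrE big_map /index_iota subn1 /=; congr (_ + _).
by apply: eq_bigr => j _; rewrite INRE RpowE.
Qed.

(** At [z = iy] a support of even size [k] contributes [(-1)^(k/2) (iy)^(n-k)]. Since
    [(-1)^(k/2) = i^k], every term carries the same factor [i^n]. *)
Lemma charpoly_evalC_imaginary (n : nat) (A : 'M[int]_n) (y : R) :
  Delta1 A -> y != 0 ->
  toC (charpoly_evalC A (0%R, y)) =
  toC (0%R, 1%R) ^+ n * toC ((y ^ n * psi A (/ y))%R, 0%R).
Proof.
move=> A_D1 y0; rewrite charpoly_evalC_horner char_poly_linear_perms //.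
rewrite rmorph_sum horner_sum psiE // RpowE RmultE RinvE mulr_sumr.
rewrite [toC (_, 0%R)](rmorph_sum (real_complex R)) mulr_sumr.
apply: eq_bigr => s s_lin.
have i2 : toC (0%R, 1%R) ^+ 2 = -1 by exact: (sqr_i R).
have yE : toC (0%R, y) = toC (0%R, 1%R) * real_complex R y.
  rewrite -[real_complex R y]/(toC (y, 0%R)) -toC_mul /toC /=; congr Complex; ring.
rewrite rmorphM /= map_polyC map_polyXn hornerM hornerC hornerXn /=.
have le_s := card_supp_le s.
have ev := negPf (linear_perm_even A_D1 s_lin).
have -> : y ^+ n * y^-1 ^+ #|supp s| = y ^+ (n - #|supp s|).
  by rewrite exprVn -expfB_cond // (negPf y0).
rewrite yE exprMn (rmorphXn (real_complex R)) mulrA; congr (_ * _).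
rewrite -[in RHS](subnK le_s) exprD mulrC; congr (_ * _).
rewrite -[in RHS](odd_double_half #|supp s|) ev add0n -mul2n exprM i2.
by rewrite (rmorphXn (intmul 1)) rmorphN1.
Qed.

(** Multiplication by [i] preserves the modulus; this removes the factor [i^n]. *)
Lemma Cnorm2_toC (z w : cpx) (n : nat) :
  toC z = toC (0%R, 1%R) ^+ n * toC w -> Cnorm2 z = Cnorm2 w.
Proof.
elim: n z => [|n IHn] [a b]; first by rewrite mul1r => -[-> ->]; case: w.
rewrite exprS -mulrA => eq_z.
(* One factor [i] is divided out: [a + ib = i (b - ia)]. *)
have eq_w : toC (b, (- a)%R) = toC (0%R, 1%R) ^+ n * toC w.
  have i2 : toC (0%R, 1%R) * toC (0%R, 1%R) = -1 by exact: (sqr_i R).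
  have -> : toC (b, (- a)%R) = - (toC (0%R, 1%R) * toC (a, b)).
    by rewrite -toC_mul /toC /=; congr Complex; rewrite -?RoppE; ring.
  by rewrite eq_z mulrA i2 mulN1r opprK.
by rewrite -(IHn _ eq_w) /Cnorm2 /=; ring.
Qed.

Local Open Scope R_scope.

(** * Squared moduli of the factored characteristic polynomial *)

Lemma quad_inv (w : cpx) (y : R) : y <> 0 ->
  Cnorm2 (Csub (0, y) w) = y ^ 2 * quad w (/ y).
Proof. by move=> y0; rewrite /Cnorm2 /quad /=; field. Qed.

Lemma Cnorm2_prod (zs : seq cpx) (y : R) : y <> 0 ->
  Cnorm2 (foldr (fun w acc => Cmul (Csub (0, y) w) acc) (Cof 1) zs) =
  (y ^ 2) ^ size zs * foldr (fun w acc => quad w (/ y) * acc) 1 zs.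
Proof.
move=> y0; elim: zs => [|w zs IHzs] /=; first by rewrite /Cnorm2 /=; ring.
by rewrite Cnorm2_mul quad_inv // IHzs /=; ring.
Qed.

Lemma foldr_Rplus_scale (T : eqType) (c : R) (f g : T -> R) (r : seq T) :
  (forall j, j \in r -> f j = c * g j) ->
  foldr Rplus 0 (map f r) = c * foldr Rplus 0 (map g r).
Proof.
elim: r => [|j r IHr] fg /=; first by ring.
rewrite fg ?mem_head // IHr; first by ring.
by move=> k k_r; apply: fg; rewrite inE k_r orbT.
Qed.

(** The polynomial quotient of [psi A x - 1] by [x ^ 2]; its value at 0 is the limit of the
    integrand there. *)
Definition psi_tail (n : nat) (A : 'M[int]_n) (x : R) : R :=
  foldr Rplus 0
    (map (fun j => INR (lin_count A (2 * j)) * x ^ (2 * j.-1)) (iota 1 n./2)).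

Lemma psi_tailE (n : nat) (A : 'M[int]_n) (x : R) :
  psi A x = 1 + x ^ 2 * psi_tail A x.
Proof.
rewrite /psi /psi_tail; congr (_ + _); apply: foldr_Rplus_scale => -[|j].
  by rewrite mem_iota.
have -> : x ^ (2 * j.+1) = x ^ 2 * x ^ (2 * j) by rewrite mulnS pow_add.
by rewrite -[j.+1.-1]/j => _; ring.
Qed.

Lemma psi0 (n : nat) (A : 'M[int]_n) : psi A 0 = 1.
Proof. by rewrite psi_tailE; ring. Qed.

Lemma psi_sqr (n : nat) (A : 'M[int]_n) (zs : seq cpx) (x : R) :
  Delta1 A -> eigenvalues A zs ->
  psi A x ^ 2 = foldr (fun w acc => quad w x * acc) 1 zs.
Proof.
move=> A_D1 [size_zs eigA].
have [->|x0] := Req_dec x 0.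
  rewrite psi0 pow1; elim: zs {size_zs eigA} => //= w zs <-.
  by rewrite /quad; ring.
have y0 : / x <> 0 by exact: Rinv_neq_0_compat.
have /Cnorm2_toC := charpoly_evalC_imaginary A_D1 (introN eqP y0).
rewrite eigA Cnorm2_prod // size_zs Rinv_inv /Cnorm2 /= => eq_n.
apply: (Rmult_eq_reg_l ((/ x ^ 2) ^ n)); last first.
  by apply: pow_nonzero; apply: Rinv_neq_0_compat; apply: pow_nonzero.
have -> : (/ x ^ 2) ^ n = (/ x * (/ x * 1)) ^ n by congr (_ ^ _); field.
rewrite eq_n Rpow_mult_distr Rmult_1_r; ring.
Qed.

From Coquelicot Require Import Coquelicot.

(** * Primitive attached to one eigenvalue *)

(** The remainder of an integration by parts: its derivative is that of
    [ln (quad w x) + ln (quad w (- x))], divided by [4 * x]. It is kept apart because it is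
    continuous at 0 when [quad w] has no zero. *)
Definition rootprim_reg (w : cpx) (x : R) : R :=
  let r2 := w.1 ^ 2 + w.2 ^ 2 in
  w.2 / 4 * (ln (quad w x) - ln (quad w (- x))) +
  Rabs w.1 / 2 *
    (atan ((r2 * x - w.2) / Rabs w.1) + atan ((r2 * x + w.2) / Rabs w.1)).

(* An odd primitive of (ln (quad w x) + ln (quad w (- x))) / (4 x^2); with
   Rocq's / 0 its value at 0 is the limit 0. *)
Definition rootprim (w : cpx) (x : R) : R :=
  - (/ x * ((ln (quad w x) + ln (quad w (- x))) / 4)) + rootprim_reg w x.

Definition nonvanishing (w : cpx) : Prop := forall x, 0 < quad w x.

(** For [w = ib] with [b] nonzero, [quad w] vanishes at [/ b]. *)
Lemma nonvanishing_cases (w : cpx) : nonvanishing w ->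
  w.1 <> 0 \/ w = (0, 0).
Proof.
case: w => a b ok; case: (Req_dec a 0) => [a0|]; last by left.
case: (Req_dec b 0) => [b0|b0]; first by right; rewrite a0 b0.
have := ok (/ b); rewrite /quad /= a0.
have -> : (1 - b * / b) * ((1 - b * / b) * 1) +
  0 * / b * (0 * / b * 1) = 0 by field.
by lra.
Qed.

Lemma quad00 x : quad (0, 0) x = 1.
Proof. by rewrite /quad /=; ring. Qed.

Lemma rootprim00 x : rootprim (0, 0) x = 0.
Proof.
rewrite /rootprim /rootprim_reg !quad00 ln_1 /= Rabs_R0; rewrite /Rdiv; ring.
Qed.

Lemma rootprim_odd w x : rootprim w (- x) = - rootprim w x.
Proof.
rewrite /rootprim /rootprim_reg Ropp_involutive Rinv_opp.
set r2 := w.1 ^ 2 + w.2 ^ 2.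
have -> : (r2 * - x - w.2) / Rabs w.1 = - ((r2 * x + w.2) / Rabs w.1).
  by rewrite /Rdiv; ring.
have -> : (r2 * - x + w.2) / Rabs w.1 = - ((r2 * x - w.2) / Rabs w.1).
  by rewrite /Rdiv; ring.
by rewrite !atan_opp /Rdiv; ring.
Qed.

(** With [r2 = a ^ 2 + b ^ 2], this rests on [a ^ 2 + (r2 * x - b) ^ 2 = r2 * quad (a, b) x]. *)
Lemma is_derive_atan_quad (a b x : R) : 0 < a ->
  is_derive (fun y => atan (((a ^ 2 + b ^ 2) * y - b) / a)) x
            (a / quad (a, b) x).
Proof.
move=> a0; auto_derive; first by [].
have q0 : 0 < quad (a, b) x.
  rewrite /quad /=.
  case: (Req_dec x 0) => [->|x0]; first by nra.
  have h1 : 0 < (a * x) ^ 2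
    by apply: pow2_gt_0; apply: Rmult_integral_contrapositive_currified; lra.
  have h2 := pow2_ge_0 (1 - b * x); rewrite /= in h1 h2; lra.
have d0 : 0 < a ^ 2 + ((a ^ 2 + b ^ 2) * x - b) ^ 2.
  have h1 := pow2_ge_0 ((a ^ 2 + b ^ 2) * x - b).
  have h2 : 0 < a ^ 2 by nra.
  lra.
rewrite /quad /= in q0 d0 *.
field; repeat split; apply: Rgt_not_eq; nra.
Qed.

Lemma quad_opp (a b x : R) : quad (a, b) (- x) = quad (a, - b) x.
Proof. by rewrite /quad /=; ring. Qed.

Lemma quad_abs (a b x : R) : quad (Rabs a, b) x = quad (a, b) x.
Proof.
rewrite /quad /= !Rmult_1_r.
by case: (Rcase_abs a) => h; rewrite ?(Rabs_left _ h) ?(Rabs_right _ h); ring.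
Qed.

Lemma is_derive_ln_quad (w : cpx) (x : R) : 0 < quad w x ->
  is_derive (fun y => ln (quad w y)) x
    ((2 * (w.1 ^ 2 + w.2 ^ 2) * x - 2 * w.2) / quad w x).
Proof.
rewrite /quad => q0; auto_derive; first by rewrite /= in q0 *; lra.
by field; rewrite /= in q0 *; lra.
Qed.

(** The shape of [rootprim] with abstract logarithms [u], [v] and arctangents [f], [g]. The wanted
    derivative comes first; the bracket after it must vanish for the actual functions. *)
Lemma is_derive_primitive_comb (u v f g : R -> R) (du dv df dg b c x : R) :
  x <> 0 -> is_derive u x du -> is_derive v x dv ->
  is_derive f x df -> is_derive g x dg ->
  is_derive
    (fun y => - (/ y * ((u y + v y) / 4)) + (b / 4 * (u y - v y) + c * (f y + g y))) x
    ((u x + v x) / (4 * x ^ 2) +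
     (- ((du + dv) / (4 * x)) + b / 4 * (du - dv) + c * (df + dg))).
Proof.
move=> x0 u_ v_ f_ g_; auto_derive.
  by repeat split => //; eexists; eassumption.
rewrite (is_derive_unique _ _ _ u_) (is_derive_unique _ _ _ v_).
rewrite (is_derive_unique _ _ _ f_) (is_derive_unique _ _ _ g_).
by field.
Qed.

Lemma is_derive_rootprim (w : cpx) (x : R) : nonvanishing w -> x <> 0 ->
  is_derive (rootprim w) x ((ln (quad w x) + ln (quad w (- x))) / (4 * x ^ 2)).
Proof.
move=> ok x0; case: (nonvanishing_cases ok) => [a0|->]; last first.
  apply: (is_derive_ext (fun=> 0)) => [t|]; first by rewrite rootprim00.
  by rewrite !quad00 ln_1 Rplus_0_r /Rdiv Rmult_0_l; exact: is_derive_const.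
case: w ok a0 => a b ok /= a0.
have A0 : 0 < Rabs a by exact: Rabs_pos_lt.
have q1 := ok x; have q2 := ok (- x).
have aa : Rabs a ^ 2 = a ^ 2 by exact: pow2_abs.
have d1 := is_derive_atan_quad b x A0.
have d2 := is_derive_atan_quad (- b) x A0.
rewrite aa quad_abs in d1; rewrite aa quad_abs -quad_opp in d2.
have d3 := is_derive_ln_quad q1.
have d4 : is_derive (fun y => ln (quad (a, b) (- y))) x
    ((2 * (a ^ 2 + b ^ 2) * x + 2 * b) / quad (a, b) (- x)).
  apply: (is_derive_ext (fun y => ln (quad (a, - b) y))) => [t|].
    by rewrite quad_opp.
  rewrite quad_opp in q2; have := is_derive_ln_quad q2; rewrite -quad_opp /=.
  by congr is_derive; congr (_ / _); ring.
have {}d2 : is_derive (fun y => atan (((a ^ 2 + b ^ 2) * y + b) / Rabs a)) x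
    (Rabs a / quad (a, b) (- x)).
  apply: is_derive_ext d2 => t; congr atan; rewrite /Rdiv; ring.
have := is_derive_primitive_comb b (Rabs a / 2) x0 d3 d4 d1 d2.
rewrite /rootprim /rootprim_reg /=.
congr is_derive.
rewrite -[RHS]Rplus_0_r; congr (_ + _).
have aa' : Rabs a * Rabs a = a * a by move: aa => /=; rewrite !Rmult_1_r.
(* Once [Rabs a * Rabs a] becomes [a * a], the cancellation is an identity of rational functions in
   [a], [b] and [x]. *)
transitivity
  (- ((2 * (a ^ 2 + b ^ 2) * x - 2 * b) / quad (a, b) x +
      (2 * (a ^ 2 + b ^ 2) * x + 2 * b) / quad (a, b) (- x)) / (4 * x) +
   b / 4 * ((2 * (a ^ 2 + b ^ 2) * x - 2 * b) / quad (a, b) x -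
            (2 * (a ^ 2 + b ^ 2) * x + 2 * b) / quad (a, b) (- x)) +
   a * a / 2 * (/ quad (a, b) x + / quad (a, b) (- x))).
  by rewrite -aa' /=; field; repeat split; lra.
rewrite /quad /= in q1 q2 *; field; repeat split; nra.
Qed.

(* Up to the term ln x / x, [rootprim w x] for large x is this function at
   y = / x, and unlike [rootprim] it extends continuously to y = 0. *)
Definition rootprim_inv (w : cpx) (y : R) : R :=
  let: (a, b) := w in
  let r2 := a ^ 2 + b ^ 2 in
  let l1 := ln ((y - b) ^ 2 + a ^ 2) in
  let l2 := ln ((y + b) ^ 2 + a ^ 2) in
  - (y * (l1 + l2) / 4) + b / 4 * (l1 - l2) +
  Rabs a / 2 *
    (PI - atan (Rabs a * y / (r2 - b * y)) - atan (Rabs a * y / (r2 + b * y))).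

Lemma ln_quad_inv (a b x : R) : a <> 0 -> 0 < x ->
  ln (quad (a, b) x) = 2 * ln x + ln ((/ x - b) ^ 2 + a ^ 2).
Proof.
move=> a0 x0.
have -> : quad (a, b) x = x ^ 2 * ((/ x - b) ^ 2 + a ^ 2).
  by rewrite /quad /=; field; lra.
rewrite ln_mult; first by rewrite ln_pow //= ; lra.
  by apply: pow_lt.
have h1 := pow2_ge_0 (/ x - b); have h2 := pow2_gt_0 a a0; lra.
Qed.

(** The bound on [x] makes both arctangent arguments positive, so [atan u = PI / 2 - atan (/ u)]
    applies. The [ln x] terms cancel in the difference of logarithms and leave [- (ln x / x)] from
    their sum. *)
Lemma rootprimE_inv (w : cpx) (x : R) : w.1 <> 0 ->
  0 < x -> Rabs w.2 / (w.1 ^ 2 + w.2 ^ 2) < x ->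
  rootprim w x = - (ln x / x) + rootprim_inv w (/ x).
Proof.
case: w => a b; cbn [fst snd] => a0 x0 x_big.
have A0 : 0 < Rabs a by exact: Rabs_pos_lt.
have h2 := pow2_gt_0 a a0.
set r2 := a ^ 2 + b ^ 2 in x_big *.
have r20 : 0 < r2 by have := pow2_ge_0 b; rewrite /r2; lra.
have rx : Rabs b < r2 * x.
  have := Rmult_lt_compat_l r2 _ _ r20 x_big.
  by have -> : r2 * (Rabs b / r2) = Rabs b by field; lra.
have [bx bx'] : b < r2 * x /\ - (r2 * x) < b by apply: Rabs_def2.
rewrite /rootprim /rootprim_reg /rootprim_inv; cbn [fst snd].
rewrite quad_opp !ln_quad_inv // -/r2.
have -> : / x - - b = / x + b by ring.
have at_inv c : 0 < r2 * x - c ->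
    atan ((r2 * x - c) / Rabs a) = PI / 2 - atan (Rabs a * / x / (r2 - c * / x)).
  move=> c0.
  have -> : Rabs a * / x / (r2 - c * / x) = / ((r2 * x - c) / Rabs a).
    by field; repeat split; lra.
  rewrite atan_inv; first by ring.
  by apply: Rdiv_lt_0_compat.
rewrite at_inv; last lra.
have -> : r2 * x + b = r2 * x - - b by ring.
rewrite at_inv; last lra.
have -> : r2 - - b * / x = r2 + b * / x by ring.
field; lra.
Qed.

Lemma continuous_rootprim_inv (w : cpx) : w.1 <> 0 ->
  continuous (rootprim_inv w) 0.
Proof.
case: w => a b; cbn [fst] => a0; apply: ex_derive_continuous.
have h2 := pow2_gt_0 a a0; have h3 := pow2_ge_0 b.
rewrite /rootprim_inv; auto_derive; rewrite /= in h2 h3 *.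
by repeat split; lra.
Qed.

Lemma rootprim_inv0 (w : cpx) : rootprim_inv w 0 = Rabs w.1 * (PI / 2).
Proof.
case: w => a b; rewrite /rootprim_inv; cbn [fst snd].
have -> : (0 - b) ^ 2 = (0 + b) ^ 2 by ring.
by rewrite !Rmult_0_r /Rdiv !Rmult_0_l atan_0; field.
Qed.

Lemma is_lim_rootprim (w : cpx) : nonvanishing w ->
  is_lim (rootprim w) p_infty (Rabs w.1 * (PI / 2)).
Proof.
move=> /nonvanishing_cases[a0|->]; last first.
  apply: (is_lim_ext (fun=> 0)) => [x|]; first by rewrite rootprim00.
  by rewrite Rabs_R0 Rmult_0_l; exact: is_lim_const.
apply: (is_lim_ext_loc (fun x => - (ln x / x) + rootprim_inv w (/ x))).
  exists (Rmax 0 (Rabs w.2 / (w.1 ^ 2 + w.2 ^ 2))) => x x_big.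
  rewrite rootprimE_inv //; apply: Rle_lt_trans x_big; [exact: Rmax_l | exact: Rmax_r].
have -> : Rabs w.1 * (PI / 2) = - 0 + rootprim_inv w 0 by rewrite rootprim_inv0; ring.
apply: is_lim_plus'; first by apply: (is_lim_opp _ _ 0); exact: is_lim_div_ln_p.
apply: is_lim_comp_continuous; last exact: continuous_rootprim_inv.
by have := is_lim_inv (fun x => x) p_infty p_infty (is_lim_id _); apply.
Qed.

(** * Sum over the eigenvalues *)

Definition sumprim (zs : seq cpx) (x : R) : R :=
  foldr (fun w acc => rootprim w x + acc) 0 zs.

Lemma is_lim_sumprim (zs : seq cpx) : List.Forall nonvanishing zs ->
  is_lim (sumprim zs) p_infty (energy zs * (PI / 2)).
Proof.
elim=> [|w r ok _ IHr] /=; first by rewrite Rmult_0_l; exact: is_lim_const.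
rewrite Rmult_plus_distr_r; apply: is_lim_plus' => //; exact: is_lim_rootprim.
Qed.

Lemma sumprim_odd (zs : seq cpx) x : sumprim zs (- x) = - sumprim zs x.
Proof.
elim: zs => [|w zs IHzs] /=; first by rewrite Ropp_0.
by rewrite IHzs rootprim_odd; ring.
Qed.

Lemma sumprim0 (zs : seq cpx) : sumprim zs 0 = 0.
Proof. by have := sumprim_odd zs 0; rewrite Ropp_0; lra. Qed.

Definition sumln (zs : seq cpx) (x : R) : R :=
  foldr (fun w acc => ln (quad w x) + acc) 0 zs.

Lemma sumlnE (zs : seq cpx) x : List.Forall nonvanishing zs ->
  sumln zs x = ln (foldr (fun w acc => quad w x * acc) 1 zs).
Proof.
(* Positivity of the product is carried through the induction, as [ln_mult] requires it. *)
move=> ok; suff [-> //] : sumln zs x = ln (foldr (fun w acc => quad w x * acc) 1 zs)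
  /\ 0 < foldr (fun w acc => quad w x * acc) 1 zs.
elim: ok => [|w r ok _ [IHr r0]] /=; first by rewrite ln_1; split => //; lra.
rewrite ln_mult // IHr; split=> //; exact: Rmult_lt_0_compat.
Qed.

Lemma is_derive_sumprim (zs : seq cpx) x : List.Forall nonvanishing zs -> x <> 0 ->
  is_derive (sumprim zs) x ((sumln zs x + sumln zs (- x)) / (4 * x ^ 2)).
Proof.
move=> ok x0; elim: ok => [|w r ok _ IHr].
  by rewrite /= Rplus_0_r /Rdiv Rmult_0_l; exact: is_derive_const.
rewrite [sumln _ _]/= [sumln _ (- x)]/=.
evar_last; first by apply: is_derive_plus; [exact: is_derive_rootprim ok x0 | exact: IHr].
by rewrite /plus /=; field.
Qed.

Lemma sumprim_split (zs : seq cpx) x :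
  sumprim zs x = - (/ x * ((sumln zs x + sumln zs (- x)) / 4)) +
    foldr (fun w acc => rootprim_reg w x + acc) 0 zs.
Proof.
elim: zs => [|w zs IHzs] /=; first by rewrite /Rdiv; ring.
by rewrite IHzs /rootprim; rewrite /Rdiv; ring.
Qed.

Lemma continuous_sum_reg (zs : seq cpx) x : List.Forall nonvanishing zs ->
  continuous (fun y => foldr (fun w acc => rootprim_reg w y + acc) 0 zs) x.
Proof.
elim=> [|w r ok _ IHr] /=; first exact: continuous_const.
apply: (continuous_plus (V := R_NormedModule)) => //.
case: (nonvanishing_cases ok) => [a0|->]; last first.
  apply: (continuous_ext (fun=> 0)) => [t|]; last exact: continuous_const.
  by rewrite /rootprim_reg !quad00 /= Rabs_R0 /Rdiv; ring.
apply: ex_derive_continuous; have q1 := ok x; have q2 := ok (- x).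
rewrite /rootprim_reg; rewrite /quad /= in q1 q2 *; auto_derive.
by repeat split; lra.
Qed.

(** * The integral *)

Lemma pow_even_ge0 (x : R) (j : nat) : 0 <= x ^ (2 * j).
Proof. by rewrite pow_mult; apply: pow_le; exact: pow2_ge_0. Qed.

Lemma psi_tail_ge0 (n : nat) (A : 'M[int]_n) (x : R) : 0 <= psi_tail A x.
Proof.
rewrite /psi_tail; elim: (seq.iota _ _) => [|j r IHr]; first exact: Rle_refl.
apply: Rplus_le_le_0_compat IHr; apply: Rmult_le_pos; first exact: pos_INR.
exact: pow_even_ge0.
Qed.

Lemma psi_ge1 (n : nat) (A : 'M[int]_n) (x : R) : 1 <= psi A x.
Proof.
have h1 := pow2_ge_0 x; have h2 := psi_tail_ge0 A x.
by rewrite psi_tailE; have := Rmult_le_pos _ _ h1 h2; lra.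
Qed.

Lemma psi_opp (n : nat) (A : 'M[int]_n) (x : R) : psi A (- x) = psi A x.
Proof.
rewrite /psi; congr (_ + foldr _ _ _); apply: eq_map => j.
by congr (_ * _); rewrite !pow_mult; congr (_ ^ _); ring.
Qed.

Lemma ex_derive_psi_tail (n : nat) (A : 'M[int]_n) (x : R) : ex_derive (psi_tail A) x.
Proof.
rewrite /psi_tail; elim: (seq.iota _ _) => [|j r IHr]; first exact: ex_derive_const.
by apply: ex_derive_plus IHr; auto_derive.
Qed.

Lemma ex_derive_psi (n : nat) (A : 'M[int]_n) (x : R) : ex_derive (psi A) x.
Proof.
apply: (ex_derive_ext (fun y => 1 + y ^ 2 * psi_tail A y)) => [t|].
  by rewrite psi_tailE.
by auto_derive; exact: ex_derive_psi_tail.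
Qed.

Lemma ln_le_sub1 (y : R) : 0 < y -> ln y <= y - 1.
Proof. by move=> y0; have := exp_ineq1_le (ln y); rewrite exp_ln //; lra. Qed.

(** These are [1 - / y <= ln y <= y - 1] at [y = psi A x]; they squeeze the integrand near 0. *)
Lemma ln_psi_bounds (n : nat) (A : 'M[int]_n) (x : R) :
  x ^ 2 * (psi_tail A x / psi A x) <= ln (psi A x) <= x ^ 2 * psi_tail A x.
Proof.
have psi1 := psi_ge1 A x; split.
  have := ln_le_sub1 (Rinv_0_lt_compat (psi A x) _).
  rewrite ln_Rinv; last lra.
  have -> : x ^ 2 * (psi_tail A x / psi A x) = 1 - / psi A x.
    have -> : x ^ 2 * (psi_tail A x / psi A x) = (x ^ 2 * psi_tail A x) / psi A x.
      by rewrite /Rdiv; ring.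
    have -> : x ^ 2 * psi_tail A x = psi A x - 1 by rewrite psi_tailE; ring.
    by field; lra.
  by move=> /(_ ltac:(lra)); lra.
have psi_pos : 0 < psi A x by lra.
by have := ln_le_sub1 psi_pos; have := psi_tailE A x; lra.
Qed.

(* [integrand A 0] is the junk value 0; this is the continuous extension. *)
Definition integrand_ext (n : nat) (A : 'M[int]_n) (x : R) : R :=
  if Req_EM_T x 0 then psi_tail A 0 else integrand A x.

Lemma integrandE (n : nat) (A : 'M[int]_n) (x : R) :
  integrand A x = / x ^ 2 * ln (psi A x).
Proof. by []. Qed.

Lemma integrand_extE (n : nat) (A : 'M[int]_n) (x : R) :
  x <> 0 -> integrand_ext A x = integrand A x.
Proof. by rewrite /integrand_ext; case: Req_EM_T. Qed.

Lemma integrand_ext0 (n : nat) (A : 'M[int]_n) : integrand_ext A 0 = psi_tail A 0.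
Proof. by rewrite /integrand_ext; case: Req_EM_T. Qed.

Lemma locally'_neq0 (P : R -> Prop) :
  (forall x, x <> 0 -> P x) -> Rbar_locally' 0 P.
Proof. by move=> P_; exists (mkposreal _ Rlt_0_1) => y _; apply: P_. Qed.

Lemma is_lim_integrand0 (n : nat) (A : 'M[int]_n) :
  is_lim (integrand A) 0 (psi_tail A 0).
Proof.
have cont_tail : continuity_pt (psi_tail A) 0.
  by apply/continuity_pt_filterlim/ex_derive_continuous; exact: ex_derive_psi_tail.
have cont_psi : continuity_pt (psi A) 0.
  by apply/continuity_pt_filterlim/ex_derive_continuous; exact: ex_derive_psi.
apply: (is_lim_le_le_loc (fun x => psi_tail A x / psi A x) (psi_tail A)).
- apply: locally'_neq0 => x x0; rewrite integrandE.
  have x2 : 0 < x ^ 2 by exact: pow2_gt_0.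
  have [lo hi] := ln_psi_bounds A x.
  have ix2 : 0 < / x ^ 2 by exact: Rinv_0_lt_compat.
  split.
    have -> : psi_tail A x / psi A x =
        / x ^ 2 * (x ^ 2 * (psi_tail A x / psi A x)).
      by rewrite -Rmult_assoc Rinv_l ?Rmult_1_l //; lra.
    by apply: Rmult_le_compat_l => //; lra.
  have -> : psi_tail A x = / x ^ 2 * (x ^ 2 * psi_tail A x).
    by rewrite -Rmult_assoc Rinv_l ?Rmult_1_l //; lra.
  by apply: Rmult_le_compat_l => //; lra.
- have -> : psi_tail A 0 = psi_tail A 0 / psi A 0 by rewrite psi0; field.
  apply: (is_lim_continuity (fun x => psi_tail A x / psi A x)).
  by apply: continuity_pt_div; rewrite // psi0; lra.
- exact: is_lim_continuity.
Qed.

Lemma continuous_integrand_ext (n : nat) (A : 'M[int]_n) (x : R) :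
  continuous (integrand_ext A) x.
Proof.
case: (Req_dec x 0) => [->|x0].
  apply/continuity_pt_filterlim/continuity_pt_filterlim'.
  rewrite integrand_ext0.
  suff : is_lim (integrand_ext A) 0 (psi_tail A 0) by [].
  apply: (is_lim_ext_loc (integrand A)); last exact: is_lim_integrand0.
  by apply: locally'_neq0 => y y0; rewrite integrand_extE.
apply: (continuous_ext_loc _ (integrand A)).
  have e0 : 0 < Rabs x by exact: Rabs_pos_lt.
  (* The ball of radius [Rabs x] around [x] avoids 0. *)
  exists (mkposreal _ e0) => y; rewrite /ball /= /AbsRing_ball /= /abs /minus /plus /opp /= => xy.
  rewrite integrand_extE // => y0; move: xy; rewrite y0 Rplus_0_l Rabs_Ropp.
  exact: Rlt_irrefl.
apply: ex_derive_continuous.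
apply: (ex_derive_ext (fun y => / y ^ 2 * ln (psi A y))) => //.
have psi1 := psi_ge1 A x; have x2 := pow2_gt_0 x x0.
auto_derive; rewrite /= in x2 *; split; first lra.
by split; [exact: ex_derive_psi | split => //; lra].
Qed.

(** [F] minus the integral of [g] is continuous with zero derivative off 0. The mean value theorem
    between 0 and [b] needs the derivative only in the open interval, which omits 0. *)
Lemma is_RInt_derive_except0 (g F : R -> R) (b : R) :
  (forall x, continuous g x) -> (forall x, continuous F x) ->
  (forall x, x <> 0 -> is_derive F x (g x)) ->
  is_RInt g 0 b (F b - F 0).
Proof.
move=> cont_g cont_F dF.
have int_g x : is_RInt g 0 x (RInt g 0 x).
  by apply: RInt_correct; apply: ex_RInt_continuous => z _.
have dG x : is_derive (fun y => RInt g 0 y) x (g x).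
  apply: is_derive_RInt; last exact: cont_g.
  by exists (mkposreal _ Rlt_0_1) => y _; exact: int_g.
have [x [x1 x2]|x _|c [_]] := MVT_gen (fun x => F x - RInt g 0 x) 0 b (fun=> 0).
- have x0 : x <> 0.
    by move=> x0; move: x1 x2; rewrite x0 /Rmin /Rmax; case: Rle_dec; lra.
  evar_last; first by apply: is_derive_minus; [exact: dF | exact: dG].
  by rewrite /minus plus_opp_r.
- apply/continuity_pt_filterlim; apply: (continuous_minus (V := R_NormedModule)).
    exact: cont_F.
  by apply: ex_derive_continuous; exists (g x).
rewrite RInt_point /zero /= => eqF.
have -> : F b - F 0 = RInt g 0 b by lra.
exact: int_g.
Qed.

Lemma quad_ge0 w x : 0 <= quad w x.
Proof. by apply: Rplus_le_le_0_compat; exact: pow2_ge_0. Qed.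

Lemma nonvanishing_factors (zs : seq cpx) :
  (forall x, foldr (fun w acc => quad w x * acc) 1 zs <> 0) ->
  List.Forall nonvanishing zs.
Proof.
elim: zs => [|w zs IHzs] /= prod_neq0; first exact: List.Forall_nil.
apply: List.Forall_cons.
  move=> x; have [//|q0] := quad_ge0 w x.
  by case: (prod_neq0 x); rewrite -q0 Rmult_0_l.
by apply: IHzs => x q0; apply: (prod_neq0 x); rewrite q0 Rmult_0_r.
Qed.

Section Primitive.

Variables (n : nat) (A : 'M[int]_n) (zs : seq cpx).
Hypotheses (A_D1 : Delta1 A) (zs_eig : eigenvalues A zs).

(** The product of the factors is [psi A x ^ 2], which is at least 1, so no factor has a zero. *)
Lemma eigenvalues_nonvanishing : List.Forall nonvanishing zs.
Proof.
apply: nonvanishing_factors => x; rewrite -(psi_sqr x A_D1 zs_eig).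
by apply: pow_nonzero; have := psi_ge1 A x; lra.
Qed.

Let ok := eigenvalues_nonvanishing.

(** Both sums equal [2 * ln (psi A x)], as [psi] is even. *)
Lemma sumln_psi x : (sumln zs x + sumln zs (- x)) / 4 = ln (psi A x).
Proof.
have psi1 := psi_ge1 A x.
rewrite !sumlnE // -!(psi_sqr _ A_D1 zs_eig) psi_opp ln_pow; last lra.
by rewrite /=; field.
Qed.

Lemma is_derive_sumprim_integrand x : x <> 0 ->
  is_derive (sumprim zs) x (integrand A x).
Proof.
move=> x0.
have -> : integrand A x = (sumln zs x + sumln zs (- x)) / (4 * x ^ 2).
  by rewrite integrandE -sumln_psi; field.
exact: is_derive_sumprim.
Qed.

Lemma continuous_sumprim x : continuous (sumprim zs) x.
Proof.
case: (Req_dec x 0) => [->|x0]; last first.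
  by apply: ex_derive_continuous; exists (integrand A x); exact: is_derive_sumprim_integrand.
(* The term [/ y * ln (psi A y)] is rewritten as [y] times the continuous extension of the
   integrand, which removes the division at 0. *)
apply: (continuous_ext (fun y => - (y * integrand_ext A y) +
    foldr (fun w acc => rootprim_reg w y + acc) 0 zs)) => [y|].
  rewrite sumprim_split sumln_psi; congr (- _ + _).
  case: (Req_dec y 0) => [->|y0]; first by rewrite psi0 ln_1; ring.
  by rewrite integrand_extE // integrandE; field.
apply: (continuous_plus (V := R_NormedModule)); last exact: continuous_sum_reg.
apply: (continuous_opp (V := R_NormedModule)).
apply: (continuous_mult (K := R_AbsRing)); first exact: continuous_id.
exact: continuous_integrand_ext.
Qed.

Lemma is_RInt_integrand a b :
  is_RInt (integrand A) a b (sumprim zs b - sumprim zs a).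
Proof.
have int0 c : is_RInt (integrand A) 0 c (sumprim zs c).
  (* The two integrands differ at most at 0, an endpoint here, and equality is asked only inside the
     interval. *)
  apply: (is_RInt_ext (integrand_ext A)) => [x [x1 x2]|].
    apply: integrand_extE => x0.
    by move: x1 x2; rewrite x0 /Rmin /Rmax; case: Rle_dec; lra.
  have := @is_RInt_derive_except0 (integrand_ext A) (sumprim zs) c.
  rewrite sumprim0 Rminus_0_r; apply=> x.
  - exact: continuous_integrand_ext.
  - exact: continuous_sumprim.
  - by move=> x0; rewrite integrand_extE //; exact: is_derive_sumprim_integrand.
rewrite (_ : _ - _ = plus (opp (sumprim zs a)) (sumprim zs b)).
  by apply: is_RInt_Chasles (int0 b); apply: is_RInt_swap; exact: int0.
by rewrite /plus /opp /=; ring.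
Qed.

Lemma improper_integral_integrand :
  improper_integral (integrand A) (PI * energy zs).
Proof.
exists (fun a b => ex_RInt_Reals_0 _ _ _ (ex_intro _ _ (@is_RInt_integrand a b))).
move=> eps eps0; have lim := is_lim_sumprim ok.
have [M limM] := proj2 (is_lim_spec _ _ _) lim (mkposreal (eps / 2) (ltac:(lra))).
(* The limit bound holds strictly beyond [M], while the bounds on [a] and [b] are weak; hence
   [M + 1]. By oddness, the lower end is the same limit taken at [- a]. *)
exists (M + 1) => a b aM bM; rewrite -RInt_Reals.
rewrite (is_RInt_unique _ _ _ _ (@is_RInt_integrand a b)).
have /= h1 := limM b ltac:(lra); have /= h2 := limM (- a) ltac:(lra).
rewrite sumprim_odd in h2.
have [] := Rabs_def2 _ _ h1; have [] := Rabs_def2 _ _ h2 => *.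
by apply: Rabs_def1; lra.
Qed.

End Primitive.

(** * Monotonicity *)

Lemma foldr_Rplus_le (T : eqType) (f g : T -> R) (r : seq T) :
  (forall j, j \in r -> f j <= g j) ->
  foldr Rplus 0 (map f r) <= foldr Rplus 0 (map g r).
Proof.
elim: r => [|j r IHr] fg /=; first exact: Rle_refl.
apply: Rplus_le_compat; first by apply: fg; rewrite mem_head.
by apply: IHr => k k_r; apply: fg; rewrite inE k_r orbT.
Qed.

Lemma foldr_Rplus_lt (T : eqType) (f g : T -> R) (r : seq T) i :
  (forall j, j \in r -> f j <= g j) -> i \in r -> f i < g i ->
  foldr Rplus 0 (map f r) < foldr Rplus 0 (map g r).
Proof.
elim: r => [//|j r IHr] fg; rewrite inE => i_r fgi /=.
have fgj : f j <= g j by apply: fg; rewrite mem_head.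
have fgr k : k \in r -> f k <= g k by move=> k_r; apply: fg; rewrite inE k_r orbT.
case/orP: i_r => [/eqP ij|i_r].
  by apply: Rplus_lt_le_compat; [rewrite -ij | exact: foldr_Rplus_le].
by apply: Rplus_le_lt_compat => //; exact: IHr.
Qed.

Lemma psi_lt (n : nat) (A1 A2 : 'M[int]_n) (x : R) :
  sprec A1 A2 -> x <> 0 -> psi A1 x < psi A2 x.
Proof.
move=> [cle [i [i_n clt]]] x0; apply: Rplus_lt_compat_l.
have mem_iotaE (j : nat) : (j \in seq.iota 1 n./2) = (1 <= j <= n./2)%nat.
  by rewrite mem_iota add1n ltnS.
apply: (foldr_Rplus_lt (i := i)) => [j||]; rewrite ?mem_iotaE //.
  move=> /cle/leP/le_INR; apply: Rmult_le_compat_r.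
  exact: pow_even_ge0.
apply: Rmult_lt_compat_r; last by apply: lt_INR; exact/ltP.
by rewrite pow_mult; apply: pow_lt; exact: pow2_gt_0.
Qed.

Lemma integrand_lt (n : nat) (A1 A2 : 'M[int]_n) (x : R) :
  sprec A1 A2 -> x <> 0 -> integrand A1 x < integrand A2 x.
Proof.
move=> A12 x0; rewrite !integrandE; apply: Rmult_lt_compat_l.
  by apply: Rinv_0_lt_compat; exact: pow2_gt_0.
by apply: ln_increasing; [have := psi_ge1 A1 x; lra | exact: psi_lt].
Qed.

Lemma integrand0 (n : nat) (A : 'M[int]_n) : integrand A 0 = 0.
Proof. by rewrite integrandE psi0 ln_1 Rmult_0_r. Qed.

Lemma energy_lt (n : nat) (A1 A2 : 'M[int]_n) (zs1 zs2 : seq cpx) :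
  Delta1 A1 -> Delta1 A2 -> sprec A1 A2 ->
  eigenvalues A1 zs1 -> eigenvalues A2 zs2 -> energy zs1 < energy zs2.
Proof.
move=> D1 D2 A12 eig1 eig2.
pose D x := sumprim zs2 x - sumprim zs1 x.
have mvt x y : 0 <= x -> x < y ->
    exists c, x <= c <= y /\ D y - D x = (integrand A2 c - integrand A1 c) * (y - x).
  move=> x0 xy; have xy' := Rlt_le _ _ xy.
  have := MVT_gen D x y (fun c => integrand A2 c - integrand A1 c).
  rewrite /= (Rmin_left _ _ xy') (Rmax_right _ _ xy'); apply=> z z_xy.
    by apply: is_derive_minus; apply: is_derive_sumprim_integrand => //; lra.
  apply/continuity_pt_filterlim; apply: (continuous_minus (V := R_NormedModule)).
    exact: continuous_sumprim D2 eig2 _.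
  exact: continuous_sumprim D1 eig1 _.
have D_le x y : 0 <= x -> x < y -> D x <= D y.
  move=> x0 xy; have [c [_ eqD]] := mvt x y x0 xy.
  have : 0 <= (integrand A2 c - integrand A1 c) * (y - x).
    apply: Rmult_le_pos; last lra.
    (* The mean value point may be 0, where both integrands are 0; so only weak monotonicity comes
       out here. *)
    case: (Req_dec c 0) => [->|c0]; first by rewrite !integrand0; lra.
    by have := integrand_lt A12 c0; lra.
  by lra.
(* On [[1, 2]] the mean value point is away from 0, which makes the increase strict. *)
have D_pos : 0 < D 2.
  have D0 : D 0 = 0 by rewrite /D !sumprim0; ring.
  have D1_ge0 := D_le 0 1 (Rle_refl 0) Rlt_0_1.
  have [c [c12 eqD]] := mvt 1 2 ltac:(lra) ltac:(lra).
  have c0 : c <> 0 by lra.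
  by have := integrand_lt A12 c0; lra.
have limD : is_lim D p_infty (energy zs2 * (PI / 2) - energy zs1 * (PI / 2)).
  apply: is_lim_minus'; apply: is_lim_sumprim.
    exact: eigenvalues_nonvanishing D2 eig2.
  exact: eigenvalues_nonvanishing D1 eig1.
(* The fixed positive number [D 2] bounds the limit from below, so strictness survives the passage
   to infinity. *)
have /= D2_le := is_lim_le_loc (fun=> D 2) D p_infty (D 2) _ _ (is_lim_const _ _) limD.
have : D 2 <= energy zs2 * (PI / 2) - energy zs1 * (PI / 2).
  by apply: D2_le; exists 2 => x x2; apply: D_le => //; lra.
have := PI_RGT_0; move: (energy zs1) (energy zs2) => E1 E2; nra.
Qed.

Theorem theorem3p1 (n : nat) :
  (forall (A : 'M[int]_n) (zs : seq cpx),
     Delta1 A -> eigenvalues A zs ->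
     exists I : R, improper_integral (integrand A) I /\
                   energy zs = (/ PI * I)%R)
  /\
  (forall (A1 A2 : 'M[int]_n) (zs1 zs2 : seq cpx),
     Delta1 A1 -> Delta1 A2 -> sprec A1 A2 ->
     eigenvalues A1 zs1 -> eigenvalues A2 zs2 ->
     (energy zs1 < energy zs2)%R).
Proof.
split; last exact: (@energy_lt n).
move=> A zs A_D1 zs_eig; exists (PI * energy zs).
split; first exact: improper_integral_integrand.
by field; exact: PI_neq0.
Qed.
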